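(* Let $n$ be a positive integer, let $B_n=G(2,n)$ be the group of signed permutations, and let $\varphi:B_n\to B_n$ be the bijection defined by the requirement that if $g$ corresponds to $[(P_0,P_1),(Q_0,Q_1)]$ under the Robinson–Schensted correspondence for $B_n$, then $\varphi(g)$ corresponds to $[(P_0,P_1'),(Q_0,Q_1')]$, where $T'$ denotes the transpose of the tableau $T$. Then for all $g\in B_n$: (a) $\mathrm{Neg}(g)=\mathrm{Neg}(\varphi(g))$; (b) $\mathrm{Des}_G(g)=\mathrm{Des}'_G(\varphi(g))$; (c) $\mathrm{Des}_G(g^{-1})=\mathrm{Des}'_G(\varphi(g)^{-1})$.
   Context: An element $g\in B_n$ is written $g=[g(1),\ldots,g(n)]$ with $g(i)\in\{\pm1,\ldots,\pm n\}$ and $|g(1)|,\ldots,|g(n)|$ a permutation of $1,\ldots,n$; it corresponds to the colored permutation $(c_1,\ldots,c_n;\sigma)$ with $\sigma(i)=|g(i)|$ and $c_i=1$ if $g(i)<0$, $c_i=0$ otherwise (so $-j$ stands for $j^1$). The product is composition of signed permutations. $\mathrm{Neg}(g)=\{i\in\{1,\ldots,n\}:c_i(g)=1\}$. Set $g(0)=0$. Two total orders on $\{-n,\ldots,n\}$ are used: the color order $<$, given by $-1<-2<\cdots<-n<0<1<\cdots<n$, and the order $<'$, given by $-n<'\cdots<'-2<'-1<'0<'1<'\cdots<'n$. Then $\mathrm{Des}_G(g)=\{i\in\{0,\ldots,n-1\}:g(i)>g(i+1)\}$ and $\mathrm{Des}'_G(g)=\{i\in\{0,\ldots,n-1\}:g(i)>'g(i+1)\}$.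 Robinson–Schensted correspondence for $B_n$: $g\mapsto[(P_0,P_1),(Q_0,Q_1)]$, where for $\epsilon\in\{0,1\}$, $P_\epsilon$ is the tableau obtained by Schensted row insertion of the absolute values $|g(i)|$ of the entries with $c_i=\epsilon$, taken in increasing order of the positions $i$, and $Q_\epsilon$ is the corresponding recording tableau, filled with the positions $i$. This is a bijection from $B_n$ onto pairs of bitableaux $(P_0,P_1)$, $(Q_0,Q_1)$ such that $P_\epsilon,Q_\epsilon$ have the same shape, all tableaux have strictly increasing rows and columns, and the entries of $P_0$ and $P_1$ together (resp. of $Q_0$ and $Q_1$ together) are $1,\ldots,n$, each exactly once. *)

(* Defs.v *)
From HB Require Import structures.
From mathcomp Require Import all_boot all_order all_fingroup all_algebra.

Set Implicit Arguments.
Unset Strict Implicit.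
Unset Printing Implicit Defensive.

Import Order.TTheory GRing.Theory Num.Theory.
Import GroupScope.

(** * Signed permutations *)

(* The letter (j, c) is the coloured integer (j+1)^c, that is, j+1 if c is
   false and -(j+1) if c is true. *)
Definition letter (n : nat) : finType := ('I_n * bool)%type.

Definition letter_int (n : nat) (x : letter n) : int :=
  if x.2 then (- x.1.+1%:Z)%R else (x.1.+1%:Z)%R.

Definition letter_opp (n : nat) (x : letter n) : letter n := (x.1, ~~ x.2).

Lemma letter_opp_inj (n : nat) : injective (@letter_opp n).
Proof. by move=> [i b] [j c] [-> /negb_inj ->]. Qed.

Definition letter_neg (n : nat) : {perm letter n} := perm (@letter_opp_inj n).

(* The permutations g of {1, ..., n, -1, ..., -n} with g(-i) = -g(i); the
   product g * h is composition, g being applied first. *)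
Definition signed_perms (n : nat) : {group {perm letter n}} :=
  'C[letter_neg n]%G.

Notation B n := (subg_of (signed_perms n)).

(* The position i : 'I_n stands for i+1, so this is g(i+1). *)
Definition entry (n : nat) (g : B n) (i : 'I_n) : letter n :=
  sgval g (i, false).

Definition Neg (n : nat) (g : B n) : {set 'I_n} := [set i | (entry g i).2].

(* The sequence g(0) = 0, g(1), ..., g(n). *)
Definition window (n : nat) (g : B n) : seq int :=
  0%R :: [seq letter_int (entry g i) | i <- enum 'I_n].

Definition sp_at (n : nat) (g : B n) (k : nat) : int := nth 0%R (window g) k.

(** * Descents *)

(* -1 < -2 < ... < -n < 0 < 1 < ... < n *)
Definition color_lt (x y : int) : bool :=
  if (x < 0)%R && (y < 0)%R then (y < x)%R else (x < y)%R.

Definition DesG (n : nat) (g : B n) : {set 'I_n} :=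
  [set i : 'I_n | color_lt (sp_at g i.+1) (sp_at g i)].

Definition DesG' (n : nat) (g : B n) : {set 'I_n} :=
  [set i : 'I_n | (sp_at g i.+1 < sp_at g i)%R].

(** * The Robinson-Schensted correspondence *)

(* The list of rows, from top to bottom, without empty rows. *)
Definition tableau := seq (seq nat).

(* Row insertion of x in t; the second component is the index of the row in
   which the new box is created. *)
Fixpoint row_insert (t : tableau) (x : nat) : tableau * nat :=
  if t is r :: t' then
    let k := find (fun y => x < y) r in
    if k < size r then
      let: (t'', i) := row_insert t' (nth 0 r k) in
      (set_nth 0 r k x :: t'', i.+1)
    else (rcons r x :: t', 0)
  else ([:: [:: x]], 0).

Definition add_box (t : tableau) (i : nat) (a : nat) : tableau :=
  set_nth [::] t i (rcons (nth [::] t i) a).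

(* The pair (a, x) of a two-line array inserts x and records a. *)
Definition rs_step (PQ : tableau * tableau) (ax : nat * nat) :
    tableau * tableau :=
  let: (P, i) := row_insert PQ.1 ax.2 in (P, add_box PQ.2 i ax.1).

Definition rs_array (w : seq (nat * nat)) : tableau * tableau :=
  foldl rs_step ([::], [::]) w.

(* The pairs (i, |g(i)|) with c_i(g) = c, by increasing i. *)
Definition color_array (n : nat) (g : B n) (c : bool) : seq (nat * nat) :=
  [seq (i.+1, (entry g i).1.+1) | i : 'I_n <- enum 'I_n & (entry g i).2 == c].

Definition bitableau := (tableau * tableau)%type.

Definition RS (n : nat) (g : B n) : bitableau * bitableau :=
  let: (P0, Q0) := rs_array (color_array g false) in
  let: (P1, Q1) := rs_array (color_array g true) in
  ((P0, P1), (Q0, Q1)).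

Definition transpose (t : tableau) : tableau :=
  [seq [seq nth 0 r j | r <- t & j < size r] | j <- iota 0 (size (head [::] t))].

Definition transpose1 (T : bitableau) : bitableau := (T.1, transpose T.2).

(* phi g is the signed permutation corresponding to
   [(P0, P1'), (Q0, Q1')] if g corresponds to [(P0, P1), (Q0, Q1)].
   It exists and is unique because RS is a bijection onto the pairs of
   standard bitableaux of the same shape, so the default value g of odflt is
   never used. *)
Definition phi (n : nat) (g : B n) : B n :=
  odflt g
    [pick h : B n | RS h == (transpose1 (RS g).1, transpose1 (RS g).2)].

(* Main.v *)
Require Import Defs.
From mathcomp Require Import all_boot all_order all_fingroup all_algebra.
From mathcomp Require Import zify.

Set Implicit Arguments.
Unset Strict Implicit.
Unset Printing Implicit Defensive.

Import GroupScope.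

(* Two adjacent letters of different colours form a descent according to their
   colours alone, for either order. Two of the same colour belong to the same
   word, whose descents at consecutive positions k, k+1 can be read off the
   recording tableau (k+1 lies in a lower row than k, by the row bumping
   lemma), and whose inverse descents at consecutive values k, k+1 can be read
   off the insertion tableau in the same way, since row insertion does not
   change which of k, k+1 is lower. Transposing a standard tableau exchanges
   "lower" with "not lower", which matches the reversal of the order on the
   negative letters between < and <'. That phi g exists rests on the
   surjectivity of the Robinson-Schensted map, obtained by reverse row
   insertion from the corner containing the largest recorded entry. *)

(** * Row insertion and standard tableaux *)

(** The relation between a row [r] and the row [s] just below it. It holds whenever [s] is empty, so
    the last row needs no separate clause. *)
Definition dominates (r s : seq nat) : Prop :=
  size s <= size r /\ forall j, j < size s -> nth 0 r j < nth 0 s j.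

(** Standardness on an arbitrary set of entries, since each colour uses only part of 1, ..., n.
    Distinctness of the entries is stated apart, as [uniq (flatten t)]. *)
Fixpoint std (t : tableau) : Prop :=
  if t is r :: t' then
    [/\ r != [::], sorted ltn r, dominates r (head [::] t') & std t']
  else True.

Definition row_size (t : tableau) (i : nat) : nat := size (nth [::] t i).

(** Beyond the last row [nth] returns the empty row, for which the last two conditions hold
    trivially, so only the first one bounds the index. *)
Lemma stdP (t : tableau) :
  std t <-> [/\ forall i, i < size t -> 0 < row_size t i,
                forall i, sorted ltn (nth [::] t i)
              & forall i, dominates (nth [::] t i) (nth [::] t i.+1)].
Proof.
elim: t => [|r t IH] /=.
  by split=> // _; split=> // i; rewrite !nth_nil.
split.
  case=> r0 sr drt /IH[H1 H2 H3]; split.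
  - by case=> [|i] /= lti; [rewrite /row_size /= lt0n size_eq0 | apply: H1].
  - by case.
  - by case=> //=; rewrite nth0.
case=> [H1 H2 H3]; split.
- by rewrite -size_eq0 -lt0n (H1 0).
- exact: (H2 0).
- by have := H3 0; rewrite /= nth0.
- by apply/IH; split=> i;
    [apply: (H1 i.+1) | apply: (H2 i.+1) | apply: (H3 i.+1)].
Qed.

Lemma row_size_gt0 (t : tableau) i : std t -> (0 < row_size t i) = (i < size t).
Proof.
move=> /stdP[H _ _]; apply/idP/idP; last exact: H.
by case: (ltnP i) => // le; rewrite /row_size nth_default.
Qed.

Lemma std_rows (t : tableau) : std t -> all (sorted ltn) t.
Proof. by elim: t => //= r t IH [_ -> _ /IH]. Qed.

Lemma leq_row_size (t : tableau) i j :
  std t -> i <= j -> row_size t j <= row_size t i.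
Proof.
move=> /stdP[_ _ H] /subnK <-; elim: (j - i) => //= d IH.
by apply: leq_trans IH; rewrite addSn; case: (H (d + i)).
Qed.

(** * Bumping in one row, and row insertion *)

Lemma sorted_ltn_nth (s : seq nat) i j :
  sorted ltn s -> i < j -> j < size s -> nth 0 s i < nth 0 s j.
Proof.
move=> ss lij ltj; apply: (sorted_ltn_nth ltn_trans) => //.
by rewrite inE (ltn_trans lij).
Qed.

(** At index [size r], [set_nth] appends, so this formula is the new row both when [x] expels an
    entry and when [x] is placed at the end. *)
Definition bump (r : seq nat) (x : nat) : seq nat :=
  set_nth 0 r (find (fun y => x < y) r) x.

Lemma row_insert_cons r t x :
  let k := find (fun y => x < y) r in
  row_insert (r :: t) x =
    if k < size r then
      (bump r x :: (row_insert t (nth 0 r k)).1,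
       (row_insert t (nth 0 r k)).2.+1)
    else (bump r x :: t, 0).
Proof.
rewrite /= /bump; set k := find _ _.
case: ltnP => [_|le]; first by case: (row_insert _ _).
have -> : k = size r by apply/eqP; rewrite eqn_leq le find_size.
by congr (_ :: _, _); elim: r {k le} => //= y r ->.
Qed.

Lemma head_row_insert t x :
  head [::] (row_insert t x).1 = bump (head [::] t) x.
Proof. by case: t => [|r t] //; rewrite row_insert_cons; case: ifP. Qed.

(** The entries of an increasing row that exceed [x] form a final segment, starting at the insertion
    point. This turns comparisons of values into comparisons of columns. *)
Lemma ltn_nth_find r x j : sorted ltn r -> j < size r ->
  (x < nth 0 r j) = (find (fun y => x < y) r <= j).
Proof.
move=> sr ltj; case: (leqP (find _ r) j) => [le|/(before_find 0) //].
have hasx : has (fun y => x < y) r by rewrite has_find (leq_ltn_trans le).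
have := nth_find 0 hasx; move: le; rewrite leq_eqVlt => /predU1P[->|lt] //= lx.
exact: ltn_trans lx (sorted_ltn_nth sr lt ltj).
Qed.

Lemma nth_bump r x j :
  nth 0 (bump r x) j = if j == find (fun y => x < y) r then x else nth 0 r j.
Proof. by rewrite nth_set_nth /=. Qed.

Lemma size_bump r x :
  size (bump r x) = maxn (find (fun y => x < y) r).+1 (size r).
Proof. by rewrite size_set_nth. Qed.

Lemma mem_bump_self r x : x \in bump r x.
Proof.
apply/(nthP 0); exists (find (fun y => x < y) r).
  by rewrite size_bump leq_maxl.
by rewrite nth_bump eqxx.
Qed.

Lemma sorted_bump r x : sorted ltn r -> x \notin r -> sorted ltn (bump r x).
Proof.
move=> sr xr; apply/(sortedP 0) => i; rewrite size_bump !nth_bump /=.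
set k := find _ _ => lti.
have kle : k <= size r by apply: find_size.
case: eqP => [ik|/eqP ik]; case: eqP => [iSk|/eqP iSk]; try lia.
  by rewrite (@ltn_nth_find r x i.+1) //; lia.
- have ltir : i < size r by lia.
  have /negbT : (x < nth 0 r i) = false by rewrite ltn_nth_find // -/k; lia.
  rewrite -leqNgt leq_eqVlt => /predU1P[e|//].
  by case/negP: xr; rewrite -e mem_nth.
by apply: sorted_ltn_nth => //; lia.
Qed.

Lemma perm_set_nth (s : seq nat) i y :
  i < size s -> perm_eq (nth 0 s i :: set_nth 0 s i y) (y :: s).
Proof.
move=> lti; rewrite set_nthE lti -[in X in perm_eq _ X](cat_take_drop i s).
rewrite (drop_nth 0 lti); apply/seq.permP=> p /=; rewrite !count_cat /=.
lia.
Qed.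

Lemma bump_rcons r x : find (fun y => x < y) r = size r -> bump r x = rcons r x.
Proof. by rewrite /bump => ->; elim: r => //= y r ->. Qed.

Lemma find_leq_size r x : ~~ (find (fun y => x < y) r < size r) ->
  find (fun y => x < y) r = size r.
Proof. by rewrite -leqNgt => le; apply/eqP; rewrite eqn_leq le find_size. Qed.

Lemma perm_row_insert t x :
  perm_eq (flatten (row_insert t x).1) (x :: flatten t).
Proof.
elim: t x => [|r t IH] x //; rewrite row_insert_cons.
case: ifP => [ltk|/negbT/find_leq_size/bump_rcons ->] /=; last first.
  by rewrite -cats1 -catA -cat1s perm_catCA.
set u := nth 0 r _ in IH *.
apply: (@perm_trans _ (bump r x ++ u :: flatten t)).
  by rewrite perm_cat2l.
by rewrite -cat1s perm_catCA catA -cat_cons perm_cat2r /= perm_set_nth.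
Qed.

Lemma row_size_row_insert t x j :
  row_size (row_insert t x).1 j = row_size t j + (j == (row_insert t x).2).
Proof.
rewrite /row_size; elim: t x j => [|r t IH] x j.
  by case: j => [|j] //=; rewrite !nth_nil.
rewrite row_insert_cons; case: ifP => [ltk|/negbT/find_leq_size/bump_rcons ->].
  case: j => [|j] /=; last by rewrite IH.
  by rewrite size_bump addn0; apply/maxn_idPr.
by case: j => [|j] /=; rewrite ?size_rcons ?addn1 ?addn0.
Qed.

Lemma row_insert_leq t x : (row_insert t x).2 <= size t.
Proof.
elim: t x => [|r t IH] x //; rewrite row_insert_cons.
by case: ifP => // _; apply: IH.
Qed.

Lemma uniq_bumped r t x : let k := find (fun y => x < y) r in
  k < size r -> uniq (flatten (r :: t)) -> uniq (nth 0 r k :: flatten t).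
Proof.
move=> k ltk /=; rewrite cat_uniq => /and3P[_ /hasPn H ->]; rewrite andbT.
by apply/negP => /H; rewrite /= mem_nth.
Qed.

(** The entry [u] expelled from column [k] is smaller than the entry below it, so it enters the next
    row in column [k] or further left, where the entry now above it is smaller than [u]. *)
Lemma std_row_insert t x :
  std t -> uniq (x :: flatten t) -> std (row_insert t x).1.
Proof.
elim: t x => [|r t IH] x; first by [].
rewrite row_insert_cons => -[r0 sr drt stdt] xt.
have xr : x \notin r.
  by move: xt; rewrite /= mem_cat negb_or => /andP[/andP[]].
have sb := sorted_bump sr xr.
have b0 : bump r x != [::] by rewrite -size_eq0 size_bump maxnE.
have kle := find_size (fun y => x < y) r.
case: ifP => [ltk|ltk]; last first.
  split=> //; case: drt => ssz H; rewrite /dominates size_bump; split.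
    by rewrite (leq_trans ssz) ?leq_maxr.
  move=> j ltj; rewrite nth_bump; case: eqP => [jk|_]; last exact: H.
  by move: (leq_trans ltj ssz); rewrite jk ltk.
have xt' : uniq (nth 0 r (find (fun y => x < y) r) :: flatten t).
  by apply: uniq_bumped => //; case/andP: xt.
split=> //; last exact: IH.
rewrite head_row_insert; case: drt => ssz H.
move: ltk xt' kle; set k := find _ r => ltk _ kle.
set s := head [::] t in ssz H *; set u := nth 0 r k.
have ss : sorted ltn s by rewrite /s; case: (t) stdt => [|? ?] // [].
have k'k : find (fun y => u < y) s <= k.
  case: (ltnP k (size s)) => [ltks|les].
    by rewrite -ltn_nth_find // H.
  by rewrite (leq_trans (find_size _ _)).
have xu : x < u by rewrite /u ltn_nth_find.
have k's := find_size (fun y => u < y) s.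
rewrite /dominates !size_bump -/k; split; first lia.
move=> j ltj; rewrite !nth_bump -/k.
case: (j =P find _ s) => [jk'|/eqP jk']; case: (j =P k) => [jk|/eqP jk] //.
- by apply: sorted_ltn_nth => //; lia.
- by apply: ltn_trans xu _; rewrite /u -jk H; lia.
- by apply: H; lia.
Qed.

(** * Recording boxes, and the common shape of the two tableaux *)

Lemma nth_add_box t i a l :
  nth [::] (add_box t i a) l =
    if l == i then rcons (nth [::] t i) a else nth [::] t l.
Proof. by rewrite nth_set_nth /=. Qed.

Lemma row_size_add_box t i a l :
  row_size (add_box t i a) l = row_size t l + (l == i).
Proof.
rewrite /row_size nth_add_box; case: eqP => [->|_]; last by rewrite addn0.
by rewrite size_rcons addn1.
Qed.

Lemma perm_add_box t i a : i <= size t ->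
  perm_eq (flatten (add_box t i a)) (a :: flatten t).
Proof.
rewrite /add_box; elim: t i => [|r t IH] [|i] //= lei.
  by rewrite -cats1 -catA -cat1s perm_catCA.
by rewrite -cat1s perm_sym perm_catCA perm_cat2l perm_sym IH.
Qed.

Lemma mem_row (t : tableau) i x : x \in nth [::] t i -> x \in flatten t.
Proof.
case: (ltnP i (size t)) => [lti xi|le]; last by rewrite nth_default.
by apply/flattenP; exists (nth [::] t i); rewrite ?mem_nth.
Qed.

Lemma mem_cell (t : tableau) i j : j < row_size t i ->
  nth 0 (nth [::] t i) j \in flatten t.
Proof. by move=> ltj; apply: (@mem_row t i); rewrite mem_nth. Qed.

(** The tableau [u] supplies the shape: being standard with the enlarged row lengths, it ensures
    that row [i] does not become longer than the row above it. As [a] exceeds all other entries,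
    rows and columns still increase. *)
Lemma std_add_box t u i a : std t -> std u -> i <= size t ->
  (forall j, row_size u j = row_size t j + (j == i)) ->
  {in flatten t, forall x, x < a} -> std (add_box t i a).
Proof.
move=> /stdP[H1 H2 H3] stdu lei Hu Ha.
apply/stdP; split=> l.
- rewrite row_size_add_box size_set_nth => ltl.
  case: eqP => [|/eqP ne]; rewrite ?addn1 // addn0 H1 //; lia.
- rewrite nth_add_box; case: eqP => // _.
  have := H2 i; have : {in nth [::] t i, forall x, x < a}.
    by move=> x /mem_row; apply: Ha.
  case: (nth [::] t i) => [|x s] //= xs sx.
  by rewrite rcons_path sx /= xs // mem_last.
- have szle : row_size (add_box t i a) l.+1 <= row_size (add_box t i a) l.
    by rewrite !row_size_add_box -!Hu leq_row_size.
  split=> // j; move: szle.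
  rewrite -/(row_size _ _) !row_size_add_box !nth_add_box.
  have [Hl1 Hl2] := H3 l; move: Hl1; rewrite -!/(row_size _ _) => Hl1.
  case: (l.+1 =P i) => [li|_]; case: (l =P i) => [li'|_]; try lia.
  + rewrite addn1 addn0 => szle ltj; rewrite nth_rcons -li -/(row_size _ _).
    case: (ltnP j (row_size t l.+1)) => [ltj'|lej]; first exact: Hl2.
    by rewrite (_ : j == _); [apply/Ha/mem_cell; lia | lia].
  + rewrite addn1 addn0 => szle ltj; rewrite nth_rcons -li' -/(row_size _ _).
    by rewrite (_ : j < _); [exact: Hl2 | lia].
  + by rewrite !addn0 => _; apply: Hl2.
Qed.

Lemma eq_row_size_size t u : std t -> std u -> row_size t =1 row_size u ->
  size t = size u.
Proof.
move=> st su H; apply/eqP; rewrite eqn_leq.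
apply/andP; split; rewrite leqNgt -row_size_gt0 //.
  by rewrite H row_size_gt0 // ltnn.
by rewrite -H row_size_gt0 // ltnn.
Qed.

Definition std_pair (PQ : tableau * tableau) : Prop :=
  [/\ std PQ.1, std PQ.2 & row_size PQ.1 =1 row_size PQ.2].

Lemma rs_array_rcons w ax : rs_array (rcons w ax) = rs_step (rs_array w) ax.
Proof. by rewrite /rs_array foldl_rcons. Qed.

Lemma rs_stepE PQ ax : rs_step PQ ax =
  ((row_insert PQ.1 ax.2).1, add_box PQ.2 (row_insert PQ.1 ax.2).2 ax.1).
Proof. by rewrite /rs_step; case: row_insert. Qed.

Lemma sorted_rcons_ltn (s : seq nat) x :
  sorted ltn (rcons s x) = sorted ltn s && all (gtn x) s.
Proof.
rewrite !(sorted_pairwise ltn_trans) -cats1 pairwise_cat /= andbT andbC.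
by congr (_ && _); rewrite allrel1r.
Qed.

(** Induction on the last letter: its position exceeds all recorded ones, so it may be put at the
    end of the row where the insertion has just created a box. *)
Lemma rs_arrayP w : sorted ltn (unzip1 w) -> uniq (unzip2 w) ->
  [/\ std_pair (rs_array w), perm_eq (flatten (rs_array w).1) (unzip2 w)
    & perm_eq (flatten (rs_array w).2) (unzip1 w)].
Proof.
elim/last_ind: w => [|w [a x] IH] //.
rewrite rs_array_rcons rs_stepE /unzip1 /unzip2 !map_rcons.
rewrite sorted_rcons_ltn rcons_uniq => /andP[sw /allP aw] /andP[xw uw].
have [[sP sQ PQ] pP pQ] := IH sw uw.
move: (rs_array w) sP sQ PQ pP pQ => [P Q] /= sP sQ PQ pP pQ.
have uP : uniq (x :: flatten P) by rewrite /= (perm_mem pP) xw (perm_uniq pP).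
have sP' := std_row_insert sP uP.
have le : (row_insert P x).2 <= size Q.
  by rewrite -(eq_row_size_size sP sQ PQ) row_insert_leq.
split.
- split=> //=; last first.
    by move=> j; rewrite row_size_row_insert row_size_add_box PQ.
  apply: (std_add_box sQ sP') => // [j|y].
    by rewrite row_size_row_insert PQ.
  by rewrite (perm_mem pQ) => /aw.
- rewrite (perm_trans (perm_row_insert _ _)) //.
  by rewrite perm_sym perm_rcons perm_cons perm_sym.
- rewrite (perm_trans (perm_add_box _ le)) //.
  by rewrite perm_sym perm_rcons perm_cons perm_sym.
Qed.

(** * Reverse row insertion *)

Lemma std_head t : std t -> sorted ltn (head [::] t).
Proof. by case: t => [|r t] // []. Qed.

Lemma std_rcons_row r x t : std (rcons r x :: t) -> row_size t 0 <= size r ->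
  r != [::] -> std (r :: t).
Proof.
case=> _; rewrite sorted_rcons_ltn => /andP[sr _] [ssz H] stdt le r0.
split=> //; split; first by rewrite -nth0.
move=> j ltj; have := H _ ltj; rewrite nth_rcons.
by rewrite (leq_trans ltj) // -nth0.
Qed.

Lemma std_nil t : std t -> row_size t 0 <= 0 -> t = [::].
Proof. by case: t => // r t [r0 _ _ _]; rewrite leqn0 size_eq0 (negPf r0). Qed.

Lemma find_sorted_rcons r x :
  sorted ltn (rcons r x) -> find (fun y => x < y) r = size r.
Proof.
rewrite sorted_rcons_ltn => /andP[_ /allP H].
by apply: hasNfind; apply/hasPn => y /H; rewrite -leqNgt => /ltnW.
Qed.

(* The entry y expelled from the rows below replaces the largest entry of r
   smaller than y. *)
Lemma row_insert_surj t i : std t -> uniq (flatten t) -> i < size t ->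
    row_size t i.+1 < row_size t i ->
  exists u x, row_insert u x = (t, i) /\ std u.
Proof.
elim: t i => [|r t IH] [|i] //= stdrt urt lti corner.
  case/lastP: r stdrt urt corner => [|r x] stdrt urt; first by case: stdrt.
  rewrite /row_size /= size_rcons ltnS => corner.
  case: (r =P [::]) => [r0|/eqP r0].
    exists [::], x; rewrite (@std_nil t) ?r0 //; first by case: stdrt.
    by move: corner; rewrite r0.
  exists (r :: t), x; split; last exact: std_rcons_row stdrt _ _.
  have [_ /find_sorted_rcons fE _ _] := stdrt.
  by rewrite row_insert_cons bump_rcons // fE ltnn.
move: stdrt => [r0 sr [ssz H] stdt].
move: (urt); rewrite cat_uniq => /and3P[_ /hasPn urt' ut].
have [u [y [E stdu]]] := IH i stdt ut lti corner.
have yr : y \notin r.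
  apply: urt'; have := perm_row_insert u y; rewrite E => /perm_mem->.
  exact: mem_head.
have su := std_head stdu.
have hE : head [::] t = bump (head [::] u) y by rewrite -head_row_insert E.
move: ssz H; rewrite {}hE size_bump.
have := find_size (fun z => y < z) (head [::] u).
set s := head [::] u in su *; set k' := find _ s => k's ssz H.
have k0size := find_size (fun z => y < z) r.
(* In the row below, [y] stands in column [k'] and so exceeds the entry of [r] above it. The first
   entry of [r] larger than [y] is therefore further right, and [k] will be the column just before
   it. *)
have k'k0 : k' < find (fun z => y < z) r.
  rewrite ltnNge -ltn_nth_find //; last by lia.
  rewrite -leqNgt ltnW //; apply: leq_trans (H k' _) _; first by lia.
  by rewrite nth_bump eqxx.
have [k k0E] : {k | find (fun z => y < z) r = k.+1}.
  by exists (find (fun z => y < z) r).-1; lia.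
rewrite k0E in k'k0 k0size.
have ltk : k < size r by lia.
have xy : nth 0 r k < y.
  rewrite ltn_neqAle; apply/andP; split.
    by apply: contraNneq yr => <-; apply: mem_nth.
  by rewrite leqNgt ltn_nth_find // k0E ltnn.
set r1 := set_nth 0 r k y; set x := nth 0 r k.
have sz1 : size r1 = size r by rewrite size_set_nth; apply/maxn_idPr.
have nth1 j : nth 0 r1 j = if j == k then y else nth 0 r j.
  by rewrite nth_set_nth.
have sr1 : sorted ltn r1.
  apply/(sortedP 0) => j; rewrite sz1 !nth1 /= => ltj.
  case: eqP => [jk|/eqP jk]; case: eqP => [jSk|/eqP jSk]; try lia.
  - by rewrite ltn_nth_find // k0E; lia.
  - apply: ltn_trans xy; apply: sorted_ltn_nth => //; lia.
  - by apply: sorted_ltn_nth.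
(* Inserting [x] into [r1] finds column [k] again: it holds [y], which is larger than [x], and the
   entries to its left are smaller than [x]. *)
have fE : find (fun z => x < z) r1 = k.
  apply/eqP; rewrite eqn_leq -ltn_nth_find ?sz1 // nth1 eqxx xy /=.
  case kj: {1}k => [|j] //; rewrite ltnNge -ltn_nth_find ?sz1; try lia.
  rewrite nth1 -leqNgt ltnW // (_ : (j == k) = false); last by lia.
  by apply: sorted_ltn_nth; lia.
exists (r1 :: u), x; split.
  rewrite row_insert_cons fE sz1 ltk nth1 eqxx E; congr (_ :: _, _).
  apply: (@eq_from_nth _ 0).
    by rewrite size_bump fE sz1; apply/maxn_idPr.
  by move=> j _; rewrite nth_bump fE nth1; case: eqP => [->|].
split=> //; first by rewrite -size_eq0 sz1 size_eq0.
split; first by rewrite -/s; lia.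
move=> j; rewrite -/s nth1 => ltj.
(* In column [k'], [y] separates the entry of [r] from that of [s]. In column [k], the new entry [y]
   is smaller than that of [s] because [k'] is at most [k]. *)
case: eqP => [jk|_]; last first.
  have := H j; rewrite nth_bump -/k'.
  case: eqP => [jk' lt|_ -> //]; last by lia.
  apply: ltn_trans (lt _) _; first lia.
  by rewrite ltn_nth_find // jk'.
by rewrite ltn_nth_find // jk.
Qed.

(** The last box of row [i] may be removed because the row below is strictly shorter. *)
Lemma add_box_surj t i : std t -> i < size t ->
    row_size t i.+1 < row_size t i ->
  exists u a, [/\ add_box u i a = t, i <= size u & std u].
Proof.
elim: t i => [|r t IH] [|i] //= stdrt lti corner.
  case/lastP: r stdrt corner => [|r x] stdrt; first by case: stdrt.
  rewrite /row_size /= size_rcons ltnS => corner.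
  case: (r =P [::]) => [r0|/eqP r0].
    exists [::], x; rewrite (@std_nil t) ?r0 //; first by case: stdrt.
    by move: corner; rewrite r0.
  by exists (r :: t), x; split=> //; apply: std_rcons_row stdrt _ _.
have [r0 sr [ssz H] stdt] := stdrt.
have [u [a [E leu stdu]]] := IH i stdt lti corner.
exists (r :: u), a; split=> //=; first by rewrite -E.
split=> //; move: ssz H; rewrite -E -!nth0 nth_add_box.
case: eqP => [<-|_] //; rewrite size_rcons => ssz H; split; first exact: ltnW.
by move=> j ltj; have := H j; rewrite nth_rcons ltj; apply; apply: ltnW.
Qed.

Lemma max_mem (s : seq nat) : s != [::] ->
  exists2 a, a \in s & {in s, forall x, x <= a}.
Proof.
elim: s => // y [|z s] IH _.
  by exists y; rewrite ?mem_head // => x; rewrite inE => /eqP->.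
have [//|a ain aub] := IH.
case: (leqP y a) => [ya|/ltnW ay].
  by exists a => [|x]; rewrite inE ?ain ?orbT // => /predU1P[->|/aub].
exists y => [|x]; rewrite inE ?eqxx // => /predU1P[->|/aub le] //.
exact: leq_trans ay.
Qed.

(** Entries to the right of or below the largest one would be larger still, so it ends its row and
    nothing lies below it. *)
Lemma std_max_corner t : std t -> t != [::] ->
  exists u i a, [/\ add_box u i a = t, i <= size u, std u &
    row_size t i.+1 < row_size t i /\ {in flatten t, forall x, x <= a}].
Proof.
move=> stdt t0; have /stdP[nz st dt] := stdt.
have ft0 : flatten t != [::].
  by case: (t) stdt t0 => // [[|y r] t'] [].
have [a ain aub] := max_mem ft0; have /flattenP[r rt ar] := ain.
have [i lti rE] := nthP [::] rt.
have lt0 := nz _ lti; set j := (row_size t i).-1.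
have ltj : j < row_size t i by rewrite /j; lia.
have aj : a <= nth 0 (nth [::] t i) j.
  move: ar; rewrite -rE => /(nthP 0)[k ltk <-].
  have : k <= j by rewrite -ltnS /j (prednK lt0).
  rewrite leq_eqVlt => /predU1P[->//|ltkj].
  by apply/ltnW/sorted_ltn_nth.
have corner : row_size t i.+1 < row_size t i.
  rewrite ltnNge; apply/negP => le.
  have ltj' : j < row_size t i.+1 by apply: leq_trans ltj le.
  have [_ /(_ j ltj')] := dt i.
  by rewrite ltnNge (leq_trans (aub _ (mem_cell ltj'))).
have [u [b [E leu stdu]]] := add_box_surj stdt lti corner.
exists u, i, b; split=> //; split=> // x /aub xa.
rewrite (leq_trans xa) // (leq_trans aj) //.
rewrite -E nth_add_box eqxx /j -E row_size_add_box eqxx addn1 /=.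
by rewrite nth_rcons ltnn eqxx.
Qed.

(** Induction on the number of boxes: the largest entry [a] of [Q] marks the box created last, and
    undoing that step yields the last letter [(a, x)] and a smaller pair. *)
Lemma rs_array_surj P Q : std_pair (P, Q) ->
    uniq (flatten P) -> uniq (flatten Q) ->
  exists w, [/\ sorted ltn (unzip1 w), uniq (unzip2 w) & rs_array w = (P, Q)].
Proof.
move sz: (size (flatten Q)) => m.
elim: m P Q sz => [|m IH] P Q sz [/= sP sQ PQ] uP uQ.
  have Q0 : Q = [::] by case: (Q) sQ sz => // [[|y r] t'] [].
  have P0 : P = [::].
    by apply/eqP; rewrite -size_eq0 (eq_row_size_size sP sQ PQ) Q0.
  by exists [::]; rewrite P0 Q0.
have Q0 : Q != [::] by apply: contra_eq_neq sz => ->.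
have [Q1 [i [a [QE leQ1 sQ1 [corner aub]]]]] := std_max_corner sQ Q0.
have ltiP : i < size P.
  by rewrite -row_size_gt0 // PQ; apply: leq_ltn_trans corner.
have cornerP : row_size P i.+1 < row_size P i by rewrite !PQ.
have [P1 [x [PE sP1]]] := row_insert_surj sP uP ltiP cornerP.
have pP : perm_eq (x :: flatten P1) (flatten P).
  by rewrite perm_sym; have := perm_row_insert P1 x; rewrite PE.
have pQ : perm_eq (a :: flatten Q1) (flatten Q).
  by rewrite perm_sym -QE perm_add_box.
have uxP1 : uniq (x :: flatten P1) by rewrite (perm_uniq pP).
have uaQ1 : uniq (a :: flatten Q1) by rewrite (perm_uniq pQ).
have szQ1 : size (flatten Q1) = m by move: (perm_size pQ); rewrite sz => -[].
have PQ1 : row_size P1 =1 row_size Q1.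
  move=> j; have := PQ j; rewrite -QE row_size_add_box.
  by have := row_size_row_insert P1 x j; rewrite PE /= => -> /addIn.
move: (uxP1) (uaQ1) => /andP[xP1 uP1] /andP[aQ1 uQ1].
have [w [sw uw wE]] := IH P1 Q1 szQ1 (And3 sP1 sQ1 PQ1) uP1 uQ1.
have [_ pP1 pQ1] := rs_arrayP sw uw; rewrite wE /= in pP1 pQ1.
exists (rcons w (a, x)); split.
- rewrite /unzip1 map_rcons sorted_rcons_ltn sw /=; apply/allP => b.
  rewrite -(perm_mem pQ1) => bQ1; rewrite /= ltn_neqAle aub ?andbT.
    by apply: contraNneq aQ1 => <-.
  by rewrite -(perm_mem pQ) inE bQ1 orbT.
- by rewrite /unzip2 map_rcons rcons_uniq -(perm_mem pP1) xP1.
- by rewrite rs_array_rcons wE rs_stepE /= PE QE.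
Qed.

(** * Descents of tableaux *)

Arguments row_insert : simpl never.

Definition row_of (t : tableau) (x : nat) : nat := find (fun r => x \in r) t.

Arguments row_of : simpl never.

(** The usual descents of a standard tableau, as row indices grow downwards. *)
Definition tdes (t : tableau) (k : nat) : bool := row_of t k < row_of t k.+1.

Lemma row_of_cons r t x :
  row_of (r :: t) x = if x \in r then 0 else (row_of t x).+1.
Proof. by []. Qed.

Lemma mem_bump r x z : let k := find (fun y => x < y) r in
    k < size r -> uniq r -> x \notin r ->
  (z \in bump r x) = (z == x) || (z \in r) && (z != nth 0 r k).
Proof.
move=> k ltk ur xr; have pm := perm_set_nth x ltk.
have : uniq (nth 0 r k :: bump r x) by rewrite (perm_uniq pm) /= xr.
have /= := perm_mem pm z; rewrite !inE /= => E /andP[/negP ub _].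
case: (z =P nth 0 r k) E => [->|_] /=; last by rewrite andbT.
by move=> _; rewrite andbF orbF (negPf (introN idP ub)); case: eqP => // ux;
  case/negP: xr; rewrite -ux mem_nth.
Qed.

Lemma row_of_inserted t x : row_of (row_insert t x).1 x = 0.
Proof.
have : x \in head [::] (row_insert t x).1.
  by rewrite head_row_insert mem_bump_self.
by case: (row_insert t x).1 => //= r t' xr; rewrite row_of_cons xr.
Qed.

Lemma tdes_insert_succ t k : tdes (row_insert t k.+1).1 k = false.
Proof. by rewrite /tdes row_of_inserted. Qed.

(** The new [k] lands in the first row. If [k.+1] was there, it was the least entry exceeding [k]
    and has been expelled. *)
Lemma tdes_insert_pred t k : all (sorted ltn) t -> uniq (k :: flatten t) ->
  k.+1 \in flatten t -> tdes (row_insert t k).1 k.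
Proof.
case: t => [|r t] // /andP[sr _].
rewrite cons_uniq [flatten _]/= mem_cat negb_or -andbA => /and3P[kr _ _] _.
rewrite /tdes row_of_inserted.
have : head [::] (row_insert (r :: t) k).1 = bump r k.
  by rewrite head_row_insert.
case: (row_insert _ _).1 => [|r1 t1] /= h.
  by have := mem_bump_self r k; rewrite -h.
rewrite row_of_cons h; case: ifP => // /(nthP 0)[j]; rewrite size_bump nth_bump.
have := find_size (fun y => k < y) r; set f := find _ r => fsz.
case: eqP => [_ _ /eqP|/eqP jf ltj jE]; first by rewrite eqn_leq ltnn andbF.
have ltjr : j < size r by lia.
have lef : f <= j by rewrite -ltn_nth_find // jE.
have ltfj : f < j by lia.
have := sorted_ltn_nth sr ltfj ltjr; rewrite jE ltnS leqNgt.
by rewrite ltn_nth_find -/f ?leqnn //; lia.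
Qed.

Lemma tdes_cons r t k : tdes (r :: t) k =
  (k.+1 \notin r) && ((k \in r) || tdes t k).
Proof. by rewrite /tdes !row_of_cons; do 2!case: ifP. Qed.

(** Induction on the rows: only an expelled [k] or [k.+1] changes row, and then it enters the first
    of the remaining rows, where the two preceding lemmas apply. *)
Lemma tdes_row_insert t x k : all (sorted ltn) t -> uniq (x :: flatten t) ->
    k \in flatten t -> k.+1 \in flatten t ->
  tdes (row_insert t x).1 k = tdes t k.
Proof.
elim: t x => [|r t IH] x // /andP[sr st].
rewrite cons_uniq [flatten _]/= => /andP[xrt urt] krt k1rt.
have urt' := urt; move: urt'; rewrite cat_uniq => /and3P[ur /hasPn rt ut].
have xr : x \notin r by move: xrt; rewrite mem_cat negb_or => /andP[].
have xt : x \notin flatten t by move: xrt; rewrite mem_cat negb_or => /andP[].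
have xk : k != x by apply: contraNneq xrt => <-.
have xk1 : k.+1 != x by apply: contraNneq xrt => <-.
rewrite row_insert_cons; case: ifP => [ltk|/negbT/find_leq_size/bump_rcons ->].
  rewrite !tdes_cons !mem_bump // (negPf xk) (negPf xk1) /=.
  set f := find _ _ in ltk *; set u := nth 0 r f.
  have uur : u \in r by rewrite mem_nth.
  have uut : uniq (u :: flatten t) by apply: uniq_bumped.
  have xu : x < u by rewrite /u ltn_nth_find.
  rewrite !mem_cat in krt k1rt.
  have norep z : z \in r -> z \notin flatten t.
    by move=> zr; apply/negP => /rt; rewrite /= zr.
  case: (k.+1 =P u) => [k1u|/eqP k1u].
    (* u is the least entry of r above x, so k would lie strictly between *)
    have kr : k \notin r.
      apply/negP => /(nthP 0)[j ltj jE].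
      have : x < k by move: xu; rewrite -k1u ltnS leq_eqVlt eq_sym (negPf xk).
      rewrite -jE ltn_nth_find // -/f => le.
      have := leqnn k.+1; rewrite {2}k1u /u -{1}jE ltnNge.
      move: le; rewrite leq_eqVlt => /predU1P[fj|lt].
        by move: jE; rewrite -fj -/u -k1u => /eqP; rewrite eqn_leq ltnn.
      by rewrite ltnW // sorted_ltn_nth.
    rewrite (negPf kr) /= andbF /= -k1u tdes_insert_succ k1u uur //.
  rewrite andbT; case: (boolP (k.+1 \in r)) => //= k1r.
  rewrite (negPf k1r) /= in k1rt.
  case: (boolP (k \in r)) krt => [kr _|kr /= kt].
    (* Here [k] is expelled into the rows that contain [k.+1], and it comes to lie above it. *)
    case: (k =P u) => [ku|//] /=; rewrite -ku; apply: tdes_insert_pred => //.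
    by rewrite ku.
  by apply: IH.
rewrite !tdes_cons !mem_rcons !inE (negPf xk) (negPf xk1) //.
Qed.

(** The row bumping lemma. In each row, [y] enters weakly left of [x] exactly when it is smaller,
    and the entries [u] and [v] expelled by [x] and [y] then compare in the same way, so the
    induction passes to the next row. *)
Lemma row_insert_lt t x y : all (sorted ltn) t -> uniq (flatten t) ->
    x \notin flatten t -> y \notin flatten t -> x != y ->
  let (t1, i) := row_insert t x in
  (i < (row_insert t1 y).2) = (y < x).
Proof.
rewrite (surjective_pairing (row_insert t x)).
elim: t x y => [|r t IH] x y st ut xt yt xy.
  by rewrite [row_insert [::] x]/row_insert row_insert_cons /=; case: (y < x).
have /andP[sr st'] := st.
have ut' : uniq (flatten t) by move: ut; rewrite /= cat_uniq => /and3P[].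
have xr : x \notin r by move: xt; rewrite mem_cat negb_or => /andP[].
have yr : y \notin r by move: yt; rewrite mem_cat negb_or => /andP[].
have sbx := sorted_bump sr xr.
have fsz := find_size (fun z => x < z) r.
rewrite (row_insert_cons r).
set k := find (fun z => x < z) r in fsz *.
set k2 := find (fun z => y < z) (bump r x).
have ltkb : k < size (bump r x) by rewrite size_bump leq_maxl.
have k2k : (k2 <= k) = (y < x).
  by rewrite -ltn_nth_find // nth_bump eqxx.
case: ifP => ltk /=; rewrite row_insert_cons -/k2; last first.
  have szb : size (bump r x) = k.+1.
    by rewrite size_bump; apply/maxn_idPl; rewrite leqW // leqNgt ltk.
  by case: ifP => /=; rewrite -k2k szb ltnS => ->.
have szb : size (bump r x) = size r by rewrite size_bump; apply/maxn_idPr.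
have xu : x < nth 0 r k by rewrite ltn_nth_find.
case: ifP => [ltk2|/negbT]; last first.
  by rewrite szb -leqNgt -k2k => le; rewrite (leqNgt k2) (leq_trans ltk le).
rewrite /= ltnS; set u := nth 0 r k in xu *; set v := nth 0 (bump r x) k2.
have ltk2r : k2 < size r by rewrite -szb.
have uut : uniq (u :: flatten t) by apply: uniq_bumped.
have nt z : z \in r -> z \notin flatten t.
  move=> zr; move: ut => /=; rewrite cat_uniq => /and3P[_ /hasPn H _].
  by apply/negP => /H; rewrite /= zr.
have vt : v \notin flatten t.
  rewrite /v nth_bump; case: eqP => _; last by apply/nt/mem_nth.
  by move: xt; rewrite mem_cat negb_or => /andP[].
have [le|gt] := leqP k2 k.
  (* Here [v] stands in the column of [x] or to its left. *)
  have vx : v <= x.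
    have -> : x = nth 0 (bump r x) k by rewrite nth_bump eqxx.
    move: le; rewrite leq_eqVlt => /predU1P[<-//|lt].
    exact/ltnW/sorted_ltn_nth.
  have vu : v < u by apply: leq_ltn_trans xu.
  by rewrite IH // ?vu -?k2k ?le //; [case/andP: uut | rewrite neq_ltn vu orbT].
(* Here [v] comes from a column to the right of the one that held [u]. *)
have uv : u < v.
  by rewrite /v nth_bump -/k gtn_eqF // sorted_ltn_nth.
rewrite IH //; [| by case/andP: uut | by rewrite neq_ltn uv].
by rewrite -k2k (leqNgt k2) gt ltnNge ltnW.
Qed.

(** * Descents of the recording and insertion tableaux of an array *)

Lemma row_of_add_box_new t i a : i <= size t -> a \notin flatten t ->
  row_of (add_box t i a) a = i.
Proof.
rewrite /add_box; elim: t i => [|r t IH] [|i] //= lei;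
  rewrite ?mem_cat ?negb_or.
- by rewrite row_of_cons mem_head.
- by rewrite row_of_cons mem_rcons mem_head.
- by case/andP=> ar at_; rewrite row_of_cons (negPf ar) IH.
Qed.

Lemma row_of_add_box t i a b : i <= size t -> b \in flatten t -> b != a ->
  row_of (add_box t i a) b = row_of t b.
Proof.
move=> + + ba; rewrite /add_box; elim: t i => [|r t IH] [|i] //= lei.
  by rewrite !row_of_cons mem_rcons inE (negPf ba).
by rewrite mem_cat !row_of_cons; case: ifP => //= _ bt; rewrite IH.
Qed.

Lemma mem_unzip1 (w : seq (nat * nat)) a x : (a, x) \in w -> a \in unzip1 w.
Proof. by move/(map_f fst). Qed.

Lemma mem_unzip2 (w : seq (nat * nat)) a x : (a, x) \in w -> x \in unzip2 w.
Proof. by move/(map_f snd). Qed.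

(** Recorded entries never change row, so it suffices to look at the moment when [a.+1] is
    recorded. *)
Lemma tdes_recording w a x y : sorted ltn (unzip1 w) -> uniq (unzip2 w) ->
  (a, x) \in w -> (a.+1, y) \in w -> tdes (rs_array w).2 a = (y < x).
Proof.
elim/last_ind: w => [|w [b z] IH] // sbw ubw axw ayw.
move: (sbw) (ubw); rewrite /unzip1 /unzip2 !map_rcons.
rewrite sorted_rcons_ltn rcons_uniq => /andP[sw /allP aw] /andP[xw uw].
have [[sP sQ PQ] pP pQ] := rs_arrayP sw uw.
have leQ v : (row_insert (rs_array w).1 v).2 <= size (rs_array w).2.
  by rewrite -(eq_row_size_size sP sQ PQ) row_insert_leq.
rewrite rs_array_rcons rs_stepE /=.
have bQ : b \notin flatten (rs_array w).2.
  by rewrite (perm_mem pQ); apply/negP => /aw /=; rewrite ltnn.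
have a_b : (a, x) \in w.
  move: axw ayw; rewrite !mem_rcons !inE => /predU1P[[-> _]|//].
  case/predU1P=> [[/eqP]|/mem_unzip1/aw /=]; first by rewrite eqn_leq ltnn.
  by rewrite ltnNge leqnSn.
have aQ : a \in flatten (rs_array w).2.
  by rewrite (perm_mem pQ) (mem_unzip1 a_b).
have ab : a != b by apply: contraNneq bQ => <-.
move: ayw; rewrite mem_rcons inE => /predU1P[[bE zE]|ayw]; last first.
  have a1Q : a.+1 \in flatten (rs_array w).2.
    by rewrite (perm_mem pQ) (mem_unzip1 ayw).
  have a1b : a.+1 != b by apply: contraNneq bQ => <-.
  by rewrite /tdes !row_of_add_box //; apply: IH.
(* Now [a.+1] has just been recorded. No position lies strictly between [a] and [a.+1], so [(a, x)]
   is the preceding letter, and the row bumping lemma compares the last two new boxes. *)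
subst b z; rewrite /tdes row_of_add_box_new // row_of_add_box //.
case/lastP: w a_b {axw IH sbw} sw aw ubw xw uw sP sQ PQ pP pQ leQ aQ bQ
  => [|w [b z]] // axw sw aw ubw xw uw sP sQ PQ pP pQ leQ aQ bQ.
move: sw; rewrite /unzip1 map_rcons sorted_rcons_ltn => /andP[sw' /allP aw'].
have [bE zE] : (a, x) = (b, z).
  move: axw; rewrite mem_rcons inE => /predU1P[//|axw].
  have ab1 := aw' _ (mem_unzip1 axw).
  have : b < a.+1 by apply: aw; rewrite /unzip1 map_rcons mem_rcons mem_head.
  by rewrite ltnS leqNgt [_ < _]ab1.
subst b z.
move: uw xw; rewrite /unzip2 map_rcons rcons_uniq mem_rcons inE negb_or /= =>
  /andP[xw' uw'] /andP[yx yw'].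
have [[sP' sQ' PQ'] pP' pQ'] := rs_arrayP sw' uw'.
rewrite rs_array_rcons rs_stepE /= row_of_add_box_new; last first.
- by rewrite (perm_mem pQ'); apply/negP => /aw' /=; rewrite ltnn.
- by rewrite -(eq_row_size_size sP' sQ' PQ') row_insert_leq.
have := @row_insert_lt (rs_array w).1 x y (std_rows sP').
rewrite (surjective_pairing (row_insert _ x)) /=; apply=> //.
- by rewrite (perm_uniq pP').
- by rewrite (perm_mem pP').
- by rewrite (perm_mem pP').
- by rewrite eq_sym.
Qed.

(** When the later of [k] and [k.+1] is inserted, it enters the first row, which decides the
    descent; further insertions preserve it. *)
Lemma tdes_insertion w a b k : sorted ltn (unzip1 w) -> uniq (unzip2 w) ->
  (a, k) \in w -> (b, k.+1) \in w -> tdes (rs_array w).1 k = (b < a).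
Proof.
elim/last_ind: w => [|w [c z] IH] //.
rewrite /unzip1 /unzip2 !map_rcons.
rewrite sorted_rcons_ltn rcons_uniq => /andP[sw /allP aw] /andP[/= xw uw].
have [[sP sQ PQ] pP pQ] := rs_arrayP sw uw.
have uzP : uniq (z :: flatten (rs_array w).1).
  by rewrite /= (perm_mem pP) xw (perm_uniq pP).
have st := std_rows sP.
rewrite rs_array_rcons rs_stepE /= !mem_rcons !inE.
case/predU1P=> [[ac kz]|akw]; case/predU1P=> [[bc k1z]|bkw].
- by move: k1z; rewrite -kz => /eqP; rewrite eqn_leq ltnn.
- subst c z; rewrite tdes_insert_pred ?(perm_mem pP) ?(mem_unzip2 bkw) //.
  by rewrite [_ < _](aw _ (mem_unzip1 bkw)).
- subst c z; rewrite tdes_insert_succ.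
  by apply/esym/negbTE; rewrite -leqNgt ltnW // [_ < _](aw _ (mem_unzip1 akw)).
- rewrite tdes_row_insert ?(perm_mem pP) ?(mem_unzip2 akw) ?(mem_unzip2 bkw) //.
  exact: IH.
Qed.

(** * Transposition *)

Notation cell t i j := (nth 0 (nth [::] t i) j).

Definition column (t : tableau) (j : nat) : seq nat :=
  [seq nth 0 r j | r <- t & j < size r].

(** Row lengths decrease weakly, so the rows that meet column [j] are the first ones, and filtering
    out the short rows does not shift row indices. *)
Lemma size_column t i j : std t -> (i < size (column t j)) = (j < row_size t i).
Proof.
rewrite /row_size /column; elim: t i => [|r t IH] i stdt; rewrite /=.
  by rewrite nth_nil ltn0.
have [_ _ _ /IH{}IH] := stdt.
have le := @leq_row_size _ 0 i stdt isT.
case: ifP => [ltj|/negbT]; first by case: i {le} => [|i] //=; apply: IH.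
rewrite -leqNgt => lej; case: i le => [|i] le.
  rewrite IH /=; have := @leq_row_size _ 0 1 stdt isT.
  by rewrite /row_size /=; lia.
rewrite IH; have := @leq_row_size _ 0 i.+2 stdt isT.
by move: le; rewrite /row_size /=; lia.
Qed.

Lemma nth_column t i j : std t -> nth 0 (column t j) i = cell t i j.
Proof.
move=> stdt; case: (ltnP i (size (column t j))) => [|le]; last first.
  rewrite nth_default //; apply/esym; rewrite nth_default //.
  by rewrite leqNgt -[_ < _](size_column i j stdt) -leqNgt.
rewrite size_column // /row_size /column; elim: t i stdt => [|r t IH] i stdt.
  by rewrite nth_nil ltn0.
move=> lt; have := @leq_row_size _ 0 i stdt isT.
rewrite {1}/row_size => /(leq_trans lt) ltr; rewrite /= ltr.
case: i lt => [|i] //= lt; apply: IH => //; by case: stdt.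
Qed.

Lemma nth_transpose t j : std t -> nth [::] (transpose t) j = column t j.
Proof.
move=> stdt; rewrite /transpose -nth0.
case: (ltnP j (row_size t 0)) => [ltj|lej].
  by rewrite (nth_map 0) ?size_iota // nth_iota.
rewrite nth_default ?size_map ?size_iota //; apply/esym/eqP.
by rewrite -size_eq0 -leqn0 leqNgt size_column // -leqNgt.
Qed.

Lemma row_size_transpose t i j : std t ->
  (i < row_size (transpose t) j) = (j < row_size t i).
Proof. by move=> stdt; rewrite /row_size nth_transpose // size_column. Qed.

Lemma cell_transpose t i j : std t -> cell (transpose t) j i = cell t i j.
Proof. by move=> stdt; rewrite nth_transpose // nth_column. Qed.

Lemma std_cell_row t i j j' :
  std t -> j < j' -> j' < row_size t i -> cell t i j < cell t i j'.
Proof. by move=> /stdP[_ H _]; apply: sorted_ltn_nth. Qed.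

Lemma std_cell_col t i i' j :
  std t -> i < i' -> j < row_size t i' -> cell t i j < cell t i' j.
Proof.
move=> stdt; elim: i' => // i' IH; rewrite ltnS leq_eqVlt.
have /stdP[_ _ /(_ i')[_ H]] := stdt.
move=> /predU1P[->|lt] ltj; first exact: H.
apply: ltn_trans (H _ ltj); apply: IH => //.
exact: leq_trans ltj (leq_row_size stdt _).
Qed.

Lemma std_transpose t : std t -> std (transpose t).
Proof.
move=> stdt; apply/stdP; split=> [j|j|j].
- rewrite size_map size_iota -nth0 => ltj; by rewrite row_size_transpose.
- apply/(sortedP 0) => i; rewrite -/(row_size _ _) row_size_transpose // => ltj.
  by rewrite /= !cell_transpose // std_cell_col.
- split.
    rewrite -!/(row_size _ _) leqNgt; apply/negP => lt.
    have := lt; rewrite row_size_transpose // => /ltnW.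
    by rewrite -row_size_transpose // ltnn.
  move=> i; rewrite -/(row_size _ _) row_size_transpose // => lt.
  by rewrite !cell_transpose // std_cell_row.
Qed.

Lemma eq_row_size_transpose t u : std t -> std u -> row_size t =1 row_size u ->
  row_size (transpose t) =1 row_size (transpose u).
Proof.
move=> st su E j; apply/eqP; rewrite eqn_leq; apply/andP.
split; rewrite leqNgt; apply/negP => lt.
  by have := lt; rewrite row_size_transpose // E -row_size_transpose // ltnn.
by have := lt; rewrite row_size_transpose // -E -row_size_transpose // ltnn.
Qed.

(** Counting the entries that satisfy a predicate is a double sum over boxes, in which rows and
    columns are exchanged. *)
Lemma perm_transpose t : std t -> perm_eq (flatten (transpose t)) (flatten t).
Proof.
move=> stdt; apply/seq.permP => p; rewrite -!sum1_count !big_mkcond.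
rewrite !big_flatten /transpose big_map /=.
under eq_bigr => j _ do rewrite big_map big_filter.
rewrite (exchange_big_dep predT) //= big_seq [RHS]big_seq.
apply: eq_bigr => r rt; rewrite [RHS](big_nth 0).
have le : size r <= size (head [::] t).
  have [i lti <-] := nthP [::] rt; rewrite -nth0.
  exact: (leq_row_size stdt (leq0n i)).
rewrite (big_nat_widen _ _ _ _ _ le) /index_iota subn0 -big_mkcondr.
by apply: eq_bigl => j; rewrite andbC.
Qed.

Lemma cellP t x : x \in flatten t ->
  exists i j, j < row_size t i /\ cell t i j = x.
Proof.
move=> /flattenP[r /(nthP [::])[i lti <-]] /(nthP 0)[j ltj <-].
by exists i, j.
Qed.

Lemma row_of_cell t i j : uniq (flatten t) -> j < row_size t i ->
  row_of t (cell t i j) = i.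
Proof.
elim: t i => [|r t IH] i; first by rewrite /row_size nth_nil.
rewrite /= cat_uniq => /and3P[_ /hasPn H ut]; case: i => [|i] ltj.
  by rewrite row_of_cons /= mem_nth.
have /negPf := H _ (@mem_cell t i j ltj).
by rewrite row_of_cons /= => ->; rewrite IH.
Qed.

(** If [k.+1] were both strictly lower and strictly to the right of [k], the box in the row of [k]
    and the column of [k.+1] would hold a value strictly between them. If it were weakly higher and
    weakly to the left, it would be at most [k]. *)
Lemma tdes_transpose t k : std t -> uniq (flatten t) ->
  k \in flatten t -> k.+1 \in flatten t -> tdes (transpose t) k = ~~ tdes t k.
Proof.
move=> stdt ut /cellP[i [j [ltj kE]]] /cellP[i' [j' [ltj' k1E]]].
have ut' : uniq (flatten (transpose t)).
  by rewrite (perm_uniq (perm_transpose stdt)).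
have r1 : row_of t k = i by rewrite -kE row_of_cell.
have r2 : row_of t k.+1 = i' by rewrite -k1E row_of_cell.
have r3 : row_of (transpose t) k = j.
  by rewrite -kE -cell_transpose // row_of_cell ?row_size_transpose.
have r4 : row_of (transpose t) k.+1 = j'.
  by rewrite -k1E -cell_transpose // row_of_cell ?row_size_transpose.
rewrite /tdes r1 r2 r3 r4.
case: (ltnP i i') => [lti|lei]; case: (ltnP j j') => [lt|le] //=; exfalso.
  have ltij' : j' < row_size t i.
    exact: leq_trans ltj' (leq_row_size stdt (ltnW lti)).
  have := std_cell_row stdt lt ltij'; have := std_cell_col stdt lti ltj'.
  by rewrite kE k1E ltnS => h1 /leq_trans/(_ h1); rewrite ltnn.
have : cell t i' j' <= cell t i j.
  have ltj'i' : j < row_size t i'.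
    exact: leq_trans ltj (leq_row_size stdt lei).
  apply: (@leq_trans (cell t i' j)).
    move: le; rewrite leq_eqVlt => /predU1P[->//|lt].
    exact/ltnW/std_cell_row.
  move: lei; rewrite leq_eqVlt => /predU1P[->//|lt].
  exact/ltnW/std_cell_col.
by rewrite kE k1E ltnn.
Qed.

(** * Signed permutations *)

Section SignedPermutations.

Variable n : nat.
Implicit Types (g h : B n) (i j : 'I_n) (c : bool).

Lemma entry_opp g i c :
  sgval g (i, c) = ((entry g i).1, (entry g i).2 (+) c).
Proof.
case: c; last by rewrite addbF -surjective_pairing.
have /cent1P/(congr1 (fun p : {perm letter n} => p (i, false))) := subgP g.
by rewrite !permM !permE /letter_opp /= => <-; rewrite addbT.
Qed.

Lemma entry_inj g : injective (fun i => (entry g i).1).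
Proof.
move=> i j E.
(* If g(i) and g(j) agree up to sign, changing the sign of j when their colours differ makes the
   images equal. *)
have : sgval g (i, false) = sgval g (j, (entry g i).2 (+) (entry g j).2).
  by rewrite !entry_opp E addbF addbCA addbb addbF.
by move/perm_inj => [].
Qed.

Lemma entryV g i j c : entry g i = (j, c) -> entry g^-1 j = (i, c).
Proof.
move=> E; have : sgval g (i, c) = (j, false) by rewrite entry_opp E /= addbb.
rewrite /entry => <-.
have -> : sgval g^-1 = (sgval g)^-1 by [].
by rewrite permK.
Qed.

(** The map [f] extends to negative letters as an odd map, injective because the absolute values of
    [f] are distinct. *)
Lemma ex_entry (f : 'I_n -> letter n) : injective (fun i => (f i).1) ->
  exists h, forall i, entry h i = f i.
Proof.
move=> finj.
pose F (x : letter n) : letter n := ((f x.1).1, (f x.1).2 (+) x.2).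
have Finj : injective F.
  by move=> [i b] [j c] [/finj -> /addbI ->].
have FB : perm Finj \in signed_perms n.
  apply/cent1P/permP => -[i b]; rewrite !permM !permE /F /letter_opp /=.
  by rewrite addbN.
exists (subg (signed_perms n) (perm Finj)) => i.
by rewrite /entry subgK // permE /F addbF; case: (f i).
Qed.

Lemma mem_color_array g c i j :
  ((i.+1, j.+1) \in color_array g c) = (entry g i == (j, c)).
Proof.
apply/mapP/eqP => [[i']|E]; last first.
  by exists i; rewrite ?E // mem_filter mem_enum /= E eqxx inE.
rewrite mem_filter => /andP[/eqP <- _] [/val_inj-> /val_inj->].
by case: (entry g i').
Qed.

Lemma unzip1_color_array g c :
  unzip1 (color_array g c) =
    [seq (val i).+1 | i <- enum 'I_n & (entry g i).2 == c].
Proof. by rewrite /unzip1 -map_comp. Qed.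

Lemma mem_unzip1_color_array g c i :
  (i.+1 \in unzip1 (color_array g c)) = ((entry g i).2 == c).
Proof.
rewrite unzip1_color_array (mem_map (f := fun i : 'I_n => (val i).+1)).
  by rewrite mem_filter mem_enum andbT.
by move=> a b [/val_inj].
Qed.

Lemma mem_unzip2_color_array g c j :
  (j.+1 \in unzip2 (color_array g c)) = ((entry g^-1 j).2 == c).
Proof.
rewrite /unzip2 -map_comp; apply/mapP/eqP => [[i]|E].
  rewrite mem_filter => /andP[/eqP ec _] [/val_inj jE].
  have /entryV -> // : entry g i = (j, c).
  by rewrite jE -ec; case: (entry g i).
have /entryV : entry g^-1 j = ((entry g^-1 j).1, c).
  by rewrite -E; case: (entry g^-1 j).
rewrite invgK => Ei; exists (entry g^-1 j).1; last by rewrite /= Ei.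
by rewrite mem_filter mem_enum /= Ei eqxx inE.
Qed.

Lemma sorted_color_array g c : sorted ltn (unzip1 (color_array g c)).
Proof.
rewrite unzip1_color_array sorted_map; apply: sorted_filter.
  by move=> a b d; rewrite /= !ltnS; apply: ltn_trans.
have := iota_ltn_sorted 0 n; rewrite -val_enum_ord sorted_map.
by apply: sub_sorted => i j.
Qed.

Lemma uniq_color_array g c : uniq (unzip2 (color_array g c)).
Proof.
rewrite /unzip2 -map_comp map_inj_uniq.
  by rewrite filter_uniq // enum_uniq.
by move=> i j [/val_inj/entry_inj].
Qed.

Lemma RSE g : RS g =
  (((rs_array (color_array g false)).1, (rs_array (color_array g true)).1),
   ((rs_array (color_array g false)).2, (rs_array (color_array g true)).2)).
Proof. by rewrite /RS; do 2!case: rs_array. Qed.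

(** Adjacent letters of different colours compare by colour alone. Both orders agree on positive
    letters and are opposite on negative ones, whence the sign [c]. *)
Lemma DesG_DesG' g h :
    (forall i, (entry g i).2 = (entry h i).2) ->
    (forall i j c, j = i.+1 :> nat -> (entry g i).2 = c -> (entry g j).2 = c ->
      ((entry h j).1 < (entry h i).1) =
        c (+) ((entry g j).1 < (entry g i).1)) ->
  DesG g = DesG' h.
Proof.
move=> Ec Ed; apply/setP => j; rewrite !inE.
have at_S g' (i : 'I_n) : sp_at g' i.+1 = letter_int (entry g' i).
  by rewrite /sp_at /window /= (nth_map i) ?size_enum_ord // nth_ord_enum.
rewrite !at_S; case j0 : (nat_of_ord j) => [|k].
  (* At index 0, both orders give a descent exactly when the first letter is negative. *)
  rewrite /sp_at /= /letter_int -Ec; case: ifP => _ //.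
have ltk : k < n by rewrite ltnW // -j0.
have := Ed (Ordinal ltk) j _ j0; have := Ec j; have := Ec (Ordinal ltk).
rewrite !(at_S _ (Ordinal ltk)).
have := @entry_inj h (Ordinal ltk) j.
case: (entry g j) => y d; case: (entry g _) => x c.
case: (entry h j) => y' d'; case: (entry h _) => x' c' /= hinj <- <-.
rewrite /color_lt /letter_int /=.
move=> H.
case: c d H => [] [] /= H; try lia.
- have := H _ erefl erefl => /=.
  (* Distinct absolute values turn the negated comparison into the reversed strict one. *)
  have : x' != y' :> nat.
    by apply/eqP => /val_inj /hinj E; move: j0; rewrite -E /=; lia.
  lia.
- have := H _ erefl erefl => /=; lia.
Qed.

End SignedPermutations.

(** * Existence of [phi] and its effect on colours and descents *)

Lemma eq_from_unzip1 (s t : seq (nat * nat)) : unzip1 s = unzip1 t ->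
  uniq (unzip1 t) -> {subset s <= t} -> s = t.
Proof.
elim: s t => [|[a x] s IH] [|[b y] t] //= [<- st] /andP[aN ut] sub.
have ayE : (a, x) = (a, y).
  have := sub _ (mem_head _ _); rewrite inE => /predU1P[//|/mem_unzip1].
  by rewrite (negPf aN).
case: ayE sub => <- sub; congr (_ :: _); apply: IH => // -[d z] dz.
have := sub (d, z); rewrite !inE dz orbT => /(_ isT)/predU1P[[da _]|//].
by case/negP: aN; rewrite -da -st; apply: mem_unzip1 dz.
Qed.

(** Transposition keeps the entries of each tableau, so the array given by surjectivity uses the
    same values and, being sorted, the same list of positions. *)
Lemma transpose_array w : sorted ltn (unzip1 w) -> uniq (unzip2 w) ->
  exists v, [/\ unzip1 v = unzip1 w, perm_eq (unzip2 v) (unzip2 w) &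
    rs_array v = (transpose (rs_array w).1, transpose (rs_array w).2)].
Proof.
move=> sw uw; have [[sP sQ PQ] pP pQ] := rs_arrayP sw uw.
have pPt := perm_trans (perm_transpose sP) pP.
have pQt := perm_trans (perm_transpose sQ) pQ.
have stt : std_pair (transpose (rs_array w).1, transpose (rs_array w).2).
  by split; [apply: std_transpose.. | apply: eq_row_size_transpose].
have uPt : uniq (flatten (transpose (rs_array w).1)) by rewrite (perm_uniq pPt).
have uQt : uniq (flatten (transpose (rs_array w).2)).
  by rewrite (perm_uniq pQt) (sorted_uniq ltn_trans ltnn).
have [v [sv uv vE]] := rs_array_surj stt uPt uQt.
have [_ pv2 pv1] := rs_arrayP sv uv; rewrite vE /= in pv1 pv2.
exists v; split=> //.
  apply: (irr_sorted_eq ltn_trans ltnn sv sw) => a.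
  by rewrite -(perm_mem pv1) (perm_mem pQt).
by rewrite perm_sym (perm_trans _ pv2) // perm_sym.
Qed.

Section Phi.

Variable n : nat.
Implicit Types (g h : B n) (i j : 'I_n) (c : bool).

Definition RS_transposed g : bitableau * bitableau :=
  (transpose1 (RS g).1, transpose1 (RS g).2).

Lemma RS_transposed_onto g : exists h, RS h = RS_transposed g.
Proof.
have [w [w1 w2 wE]] :=
  transpose_array (sorted_color_array g true) (uniq_color_array g true).
have uw2 : uniq (unzip2 w) by rewrite (perm_uniq w2) uniq_color_array.
have uw1 : uniq (unzip1 w).
  by rewrite w1 (sorted_uniq ltn_trans ltnn) ?sorted_color_array.
(* The array [w] pairs each position of a negative letter with its new value [v i]; at the other
   positions [v i] is arbitrary. *)
have /fin_all_exists[v vP] i : exists x : 'I_n,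
    (entry g i).2 -> (i.+1, x.+1) \in w.
  case: (boolP (entry g i).2) => [ei|_]; last by exists i.
  have : i.+1 \in unzip1 w by rewrite w1 mem_unzip1_color_array ei.
  case/mapP=> -[a y] ayw /= iE; have := mem_unzip2 ayw.
  rewrite (perm_mem w2) => /mapP[[b z]] /mapP[x _ [_ zE]] /= yE.
  by exists (entry g x).1 => _; rewrite iE -zE -yE.
(* The values in [w] are those of the negative letters of [g], so the new negative letters cannot
   collide with the positive ones, which [f] keeps. *)
have vcol i : (entry g i).2 -> (entry g^-1 (v i)).2.
  move=> /vP/mem_unzip2; rewrite (perm_mem w2) mem_unzip2_color_array.
  by move=> /eqP.
have invE i : entry g^-1 (entry g i).1 = (i, (entry g i).2).
  by apply: entryV; case: (entry g i).
pose f i := if (entry g i).2 then (v i, true) else entry g i.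
have finj : injective (fun i => (f i).1).
  move=> i j; rewrite /f.
  case ei: (entry g i).2; case ej: (entry g j).2 => /= E.
  - have := vP _ ei; have := vP _ ej; rewrite E => jw iw; apply/val_inj.
    have [k] := nthP (0, 0) iw; have [k'] := nthP (0, 0) jw.
    move=> ltk' kE' ltk kE; suff ee : k = k'.
      by move: kE; rewrite ee kE' => -[].
    apply/eqP; rewrite -(nth_uniq 0 _ _ uw2) ?size_map //.
    by rewrite !(nth_map (0, 0)) // kE kE'.
  - by have := vcol _ ei; rewrite E invE ej.
  - by have := vcol _ ej; rewrite -E invE ei.
  - exact: entry_inj E.
have [h hE] := ex_entry finj; exists h.
have colE i : (entry h i).2 = (entry g i).2.
  by rewrite hE /f; case e: (entry g i).2.
have filE c : [seq i <- enum 'I_n | (entry h i).2 == c]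
            = [seq i <- enum 'I_n | (entry g i).2 == c].
  by apply: eq_filter => i; rewrite colE.
have a0 : color_array h false = color_array g false.
  rewrite /color_array filE; apply/eq_in_map => i.
  by rewrite mem_filter hE /f => /andP[/eqP -> _].
have a1 : color_array h true = w.
  apply: eq_from_unzip1 => //.
    by rewrite w1 !unzip1_color_array filE.
  move=> _ /mapP[i + ->]; rewrite mem_filter colE => /andP[/eqP ei _].
  by rewrite hE /f ei /= vP.
by rewrite /RS_transposed !RSE a0 a1 wE.
Qed.

Lemma RS_phi g : RS (phi g) = RS_transposed g.
Proof.
rewrite /phi; case: pickP => [h /eqP //|none].
by have [h E] := RS_transposed_onto g; have := none h; rewrite E eqxx.
Qed.

Lemma rs_array_phi g c : rs_array (color_array (phi g) c) =
  let PQ := rs_array (color_array g c) in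
  if c then (transpose PQ.1, transpose PQ.2) else PQ.
Proof.
have := RS_phi g; rewrite /RS_transposed !RSE /=.
rewrite /transpose1 /= => -[P0 P1 Q0 Q1].
by case: c => /=; [rewrite -P1 -Q1 | rewrite [RHS]surjective_pairing -P0 -Q0];
  rewrite -surjective_pairing.
Qed.

Lemma color_arrayP g c : let PQ := rs_array (color_array g c) in
  [/\ std_pair PQ, perm_eq (flatten PQ.1) (unzip2 (color_array g c))
    & perm_eq (flatten PQ.2) (unzip1 (color_array g c))].
Proof. exact: rs_arrayP (sorted_color_array g c) (uniq_color_array g c). Qed.

Lemma uniq_color_arrayP g c : let PQ := rs_array (color_array g c) in
  uniq (flatten PQ.1) /\ uniq (flatten PQ.2).
Proof.
have [_ pP pQ] := color_arrayP g c.
rewrite /= (perm_uniq pP) (perm_uniq pQ) uniq_color_array.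
by rewrite (sorted_uniq ltn_trans ltnn) ?sorted_color_array.
Qed.

(** The negative positions are the entries of the second recording tableau, and transposing it does
    not change its set of entries. *)
Lemma color_phi g i : (entry g i).2 = (entry (phi g) i).2.
Proof.
have [[_ sQ _] _ pQ] := color_arrayP g true.
have [_ _ pQ'] := color_arrayP (phi g) true.
rewrite rs_array_phi /= in pQ'.
rewrite -[LHS]eqb_id -[RHS]eqb_id -!mem_unzip1_color_array.
by rewrite -(perm_mem pQ) -(perm_mem pQ') (perm_mem (perm_transpose sQ)).
Qed.

(** Likewise, the absolute values of negative letters are the entries of the second insertion
    tableau. *)
Lemma colorV_phi g i : (entry g^-1 i).2 = (entry (phi g)^-1 i).2.
Proof.
have [[sP _ _] pP _] := color_arrayP g true.
have [_ pP' _] := color_arrayP (phi g) true.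
rewrite rs_array_phi /= in pP'.
rewrite -[LHS]eqb_id -[RHS]eqb_id -!mem_unzip2_color_array.
by rewrite -(perm_mem pP) -(perm_mem pP') (perm_mem (perm_transpose sP)).
Qed.

(** Indices in ['I_n] start at 0 and tableau entries at 1, so [i] and [j] appear in the tableau as
    [i.+1] and [i.+2]. *)
Lemma descent_recording g i j c : j = i.+1 :> nat ->
    (entry g i).2 = c -> (entry g j).2 = c ->
  tdes (rs_array (color_array g c)).2 i.+1 = ((entry g j).1 < (entry g i).1).
Proof.
move=> ji ei ej.
have aw : (i.+1, (entry g i).1.+1) \in color_array g c.
  by rewrite mem_color_array -ei; case: (entry g i).
have bw : (i.+2, (entry g j).1.+1) \in color_array g c.
  by rewrite -ji mem_color_array -ej; case: (entry g j).
by rewrite (tdes_recording _ _ aw bw) ?sorted_color_array ?uniq_color_array.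
Qed.

Lemma descent_insertion g i j c : j = i.+1 :> nat ->
    (entry g^-1 i).2 = c -> (entry g^-1 j).2 = c ->
  tdes (rs_array (color_array g c)).1 i.+1
    = ((entry g^-1 j).1 < (entry g^-1 i).1).
Proof.
move=> ji ei ej.
have pre k : (entry g^-1 k).2 = c -> entry g (entry g^-1 k).1 = (k, c).
  move=> <-; have /entryV := surjective_pairing (entry g^-1 k).
  by rewrite invgK.
have aw : ((entry g^-1 i).1.+1, i.+1) \in color_array g c.
  by rewrite mem_color_array pre.
have bw : ((entry g^-1 j).1.+1, i.+2) \in color_array g c.
  by rewrite -ji mem_color_array pre.
by rewrite (tdes_insertion _ _ aw bw) ?sorted_color_array ?uniq_color_array.
Qed.

End Phi.

Theorem proposition7p2 (n : nat) (n_gt0 : (0 < n)%N) (g : B n) :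
  [/\ Neg g = Neg (phi g),
      DesG g = DesG' (phi g)
    & DesG g^-1 = DesG' (phi g)^-1].
Proof.
split.
- by apply/setP => i; rewrite !inE color_phi.
- apply: DesG_DesG' => [|i j c ji ei ej]; first exact: color_phi.
  rewrite -(descent_recording (c := c) ji) -?color_phi //.
  rewrite -(descent_recording (c := c) ji) // rs_array_phi.
  (* In colour 0 the tableau is unchanged. In colour 1 it is transposed, which complements its
     descents as the sign [c] demands. *)
  case: c ei ej => // ei ej; have [[_ sQ _] _ pQ] := color_arrayP g true.
  have [_ uQ] := uniq_color_arrayP g true.
  have iQ : i.+1 \in flatten (rs_array (color_array g true)).2.
    by rewrite (perm_mem pQ) mem_unzip1_color_array ei.
  have jQ : i.+2 \in flatten (rs_array (color_array g true)).2.
    by rewrite (perm_mem pQ) -ji mem_unzip1_color_array ej.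
  by rewrite /= tdes_transpose.
- apply: DesG_DesG' => [|i j c ji ei ej]; first exact: colorV_phi.
  rewrite -(descent_insertion (c := c) ji) -?colorV_phi //.
  rewrite -(descent_insertion (c := c) ji) // rs_array_phi.
  case: c ei ej => // ei ej; have [[sP _ _] pP _] := color_arrayP g true.
  have [uP _] := uniq_color_arrayP g true.
  have iP : i.+1 \in flatten (rs_array (color_array g true)).1.
    by rewrite (perm_mem pP) mem_unzip2_color_array ei.
  have jP : i.+2 \in flatten (rs_array (color_array g true)).1.
    by rewrite (perm_mem pP) -ji mem_unzip2_color_array ej.
  by rewrite /= tdes_transpose.
Qed.
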